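(* Let $X\neq\{0\}$ be a complex Banach space, $1\leq p<\infty$ and $\lambda\geq1$. Then there exists a constant $d>0$ such that for all $1\leq q\leq\infty$ and all integers $n>1$, $$\frac{r^n_p(B_{\ell^n_q},X,\lambda)}{n^{1/q}}\ \leq\ A_p(B_{\ell^n_q},X,\lambda)\ \leq\ d\,\frac{(\log n)^{1-\frac{1}{\min\{q,2\}}}}{n^{\frac1p+\frac{1}{\max\{2,q\}}-\frac12}},$$ with the convention $1/q=0$ for $q=\infty$.
   Context: For $1\leq q<\infty$, $B_{\ell^n_q}=\{z\in\mathbb{C}^n:(\sum_{i=1}^n|z_i|^q)^{1/q}<1\}$, and $B_{\ell^n_\infty}=\{z\in\mathbb{C}^n:\max_i|z_i|<1\}$. A complete Reinhardt domain is a domain $\Omega\subset\mathbb{C}^n$ such that $z\in\Omega$ implies $(\eta_1e^{i\theta_1}z_1,\dots,\eta_ne^{i\theta_n}z_n)\in\Omega$ for all $\eta_i\in[0,1]$, $\theta_i\in\mathbb{R}$. For such $\Omega$ and a holomorphic $f:\Omega\to X$, write $f(z)=\sum_{\alpha\in\mathbb{N}_0^n}x_\alpha(f)z^\alpha$ with $x_\alpha(f)\in X$ and $\|f\|_\Omega=\sup_{z\in\Omega}\|f(z)\|$ (an inequality whose right-hand side is infinite is regarded as satisfied). Let $H_\infty(\Omega,X)$ be the set of bounded holomorphic maps $\Omega\to X$. The $\lambda_p$-Bohr radius $r^n_p(\Omega,X,\lambda)$ is the supremum of all $r\in[0,1]$ such that $\sup_{z\in r\Omega}\sum_{\alpha\in\mathbb{N}_0^n}\|x_\alpha(f)z^\alpha\|^p\leq\lambda\|f\|_\Omega^p$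 for all holomorphic $f:\Omega\to X$. The $\lambda_p$-arithmetic Bohr radius $A_p(\Omega,X,\lambda)$ is $$A_p(\Omega,X,\lambda)=\sup\left\{\frac1n\sum_{i=1}^n r_i: r\in\mathbb{R}^n_{\geq0},\ \sum_{\alpha\in\mathbb{N}_0^n}\|x_\alpha(f)\|^p r^{p\alpha}\leq\lambda\|f\|_\Omega^p\ \text{ for all } f\in H_\infty(\Omega,X)\right\}.$$ *)

(* Defs.v *)
From HB Require Import structures.
From mathcomp Require Import all_boot all_order all_algebra finmap.
From mathcomp Require Import all_classical all_reals all_analysis.
From mathcomp Require Import complex.
From mathcomp.analysis.showcase Require Import summability.

Set Implicit Arguments.
Unset Strict Implicit.
Unset Printing Implicit Defensive.

Import Order.TTheory GRing.Theory Num.Theory.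
Import numFieldNormedType.Exports.

Local Open Scope classical_set_scope.
Local Open Scope ring_scope.
Local Open Scope complex_scope.

(* The usual topology and normed module structure on R[i]. *)
HB.instance Definition _ (R : realType) := GRing.ComAlgebra.copy R[i] R[i]^o.
HB.instance Definition _ (R : realType) := Vector.copy R[i] R[i]^o.
HB.instance Definition _ (R : realType) := NormedModule.copy R[i] R[i]^o.

(* The norm of a normedZmodType over R[i] takes its values in R[i]; these are
   nonnegative reals, so taking real parts loses nothing. *)
Definition rnorm (R : realType) (V : normedZmodType R[i]) (v : V) : R :=
  complex.Re `|v|.

(* The open unit ball of the complex l_q^n, for 1 <= q <= +oo. *)
Definition lq_ball (R : realType) (q : \bar R) (n : nat) : set 'rV[R[i]]_n :=
  match q with
  | s%:E => [set z : 'rV[R[i]]_n | (\sum_(i < n) rnorm (z 0 i) `^ s) `^ s^-1 < 1]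
  | _ => [set z : 'rV[R[i]]_n | \big[Num.max/0]_(i < n) rnorm (z 0 i) < 1]
  end.

Section Bohr.
Variables (R : realType) (n : nat) (X : completeNormedModType R[i]).
Implicit Types (Omega : set 'rV[R[i]]_n) (f : 'rV[R[i]]_n -> X).
Implicit Types (x : {ffun 'I_n -> nat} -> X) (p lambda : R).

Definition monomial (z : 'rV[R[i]]_n) (a : {ffun 'I_n -> nat}) : R[i] :=
  \prod_(i < n) z 0 i ^+ a i.

(* Maps Omega -> X are represented by total functions whose values outside
   Omega are irrelevant (Omega is open); differentiability is over R[i]. *)
Definition holomorphic_on Omega f : Prop :=
  forall z, Omega z -> differentiable f z.

(* [x] is the family of monomial coefficients x_a(f) of f, that is,
   f z = \sum_a x_a z^a (unconditionally) for all z in Omega. If Omega is a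
   complete Reinhardt domain, every holomorphic f has exactly one such family. *)
Definition monomial_coeffs Omega f x : Prop :=
  forall z, Omega z ->
    partial_sum (fun a => monomial z a *: x a) @ totally --> f z.

Definition sup_norm Omega f : \bar R :=
  ereal_sup [set (rnorm (f z))%:E | z in Omega].

Definition dilate (r : R) Omega : set 'rV[R[i]]_n :=
  [set r%:C *: w | w in Omega].

Definition bohr_admissible Omega p lambda (r : R) : Prop :=
  forall f x, holomorphic_on Omega f -> monomial_coeffs Omega f x ->
  (ereal_sup [set \esum_(a in [set: {ffun 'I_n -> nat}])
                    (rnorm (monomial z a *: x a) `^ p)%:E
             | z in dilate r Omega]
     <= lambda%:E * sup_norm Omega f `^ p)%E.

Definition bohr_radius Omega p lambda : R :=
  sup [set r | 0 <= r <= 1 /\ bohr_admissible Omega p lambda r].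

Definition arith_bohr_admissible Omega p lambda (r : 'I_n -> R) : Prop :=
  forall f x, holomorphic_on Omega f -> (sup_norm Omega f < +oo)%E ->
  monomial_coeffs Omega f x ->
  (\esum_(a in [set: {ffun 'I_n -> nat}])
      (rnorm (x a) `^ p * \prod_(i < n) r i `^ (p * (a i)%:R))%:E
     <= lambda%:E * sup_norm Omega f `^ p)%E.

(* The supremum is taken in \bar R since it may be infinite for a general
   Omega. *)
Definition arith_bohr_radius Omega p lambda : \bar R :=
  ereal_sup [set (n%:R^-1 * \sum_(i < n) r i)%:E | r in
    [set r : 'I_n -> R | (forall i, 0 <= r i) /\
                         arith_bohr_admissible Omega p lambda r]].

End Bohr.

Arguments bohr_radius {R n} X Omega p lambda.
Arguments arith_bohr_radius {R n} X Omega p lambda.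

(* Main.v *)
Require Import Defs.
From mathcomp Require Import all_boot all_order all_algebra.
From mathcomp Require Import finmap.
From mathcomp Require Import all_classical all_reals all_analysis.
From mathcomp Require Import complex ring lra.
From mathcomp.analysis.showcase Require Import summability.
Import Order.TTheory GRing.Theory Num.Theory.
Import numFieldNormedType.Exports.
Local Open Scope ring_scope.

(** The lower bound for the arithmetic Bohr radius comes from testing the Bohr
    inequality at the constant vectors [s n^(-1/q) (1, ..., 1)], [s < 1].

    For the upper bound, let [s = min(q, 2)] and
    [P(z) = \sum_(|a| = m) +-(m!/a!) z^a] with suitably chosen signs. Since
    [m!/a! <= m^m], one has [\sum_a (m!/a!)^2 |u^a|^2 <= (m^m)^(2 - 2/s)]
    whenever [\sum_i |u_i|^s <= 1]; averaging over the signs and a union bound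
    over a grid give signs for which [|P| <= 100 m n^2 (m^m)^(1 - 1/s)] on this
    set. The ball of [l_q^n] lies in its dilate by
    [rho = n^(1/2 - 1/max(2, q))]. If [r] has mean [a] and is admissible, then
    [(n a^p)^m <= (\sum_i r_i^p)^m <= \sum_a (m!/a!)^p r^(p a)], which is at
    most [lambda] times the [p]-th power of [rho^m 100 m n^2 (m^m)^(1 - 1/s)].
    Taking [m]-th roots with [m] close to [ln n] makes the polynomial factors
    in [n] and [m] bounded, so crude estimates of these factors suffice. *)

Set Implicit Arguments.
Unset Strict Implicit.
Unset Printing Implicit Defensive.

(** * Norms and differentiability over [R[i]] *)

Section Rnorm.
Variables (R : realType) (V : normedModType R[i]).
Implicit Types (v w : V) (z : R[i]).

(** This is the bridge to the [R[i]]-valued norm: identities and inequalities are transferred along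
    the embedding of [R], which is injective and reflects the order. *)
Lemma rnormE v : (rnorm v)%:C%C = `|v|.
Proof. by rewrite RRe_real// normr_real. Qed.

Lemma rnorm_ge0 v : 0 <= rnorm v.
Proof. by rewrite -ler0c rnormE. Qed.

Lemma rnorm_eq0 v : (rnorm v == 0) = (v == 0).
Proof. by rewrite -[RHS]normr_eq0 -rnormE eq_complex /= eqxx andbT. Qed.

Lemma rnorm0 : rnorm (0 : V) = 0.
Proof. by apply/eqP; rewrite rnorm_eq0. Qed.

Lemma rnormD v w : rnorm (v + w) <= rnorm v + rnorm w.
Proof. by rewrite -lecR rmorphD /= !rnormE ler_normD. Qed.

Lemma rnorm_sum (I : Type) (r : seq I) (P : pred I) (F : I -> V) :
  rnorm (\sum_(i <- r | P i) F i) <= \sum_(i <- r | P i) rnorm (F i).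
Proof.
rewrite -lecR rmorph_sum /= rnormE; apply: le_trans (ler_norm_sum _ _ _) _.
by under [leRHS]eq_bigr do rewrite rnormE.
Qed.

Lemma rnormZ z v : rnorm (z *: v) = rnorm z * rnorm v.
Proof. by apply: complexI; rewrite rmorphM /= !rnormE normrZ. Qed.

End Rnorm.

Section RnormC.
Variable R : realType.
Implicit Types (z w : R[i]) (x : R).

Lemma rnormM z w : rnorm (z * w) = rnorm z * rnorm w.
Proof. by apply: complexI; rewrite rmorphM /= !rnormE normrM. Qed.

Lemma rnorm1 : rnorm (1 : R[i]) = 1.
Proof. by rewrite /rnorm normr1. Qed.

Lemma rnorm_prod (I : Type) (r : seq I) (P : pred I) (F : I -> R[i]) :
  rnorm (\prod_(i <- r | P i) F i) = \prod_(i <- r | P i) rnorm (F i).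
Proof. by rewrite (big_morph (@rnorm R R[i]) rnormM rnorm1). Qed.

Lemma rnormX z k : rnorm (z ^+ k) = rnorm z ^+ k.
Proof. by elim: k => [|k IH]; rewrite ?expr0 ?rnorm1// !exprS rnormM IH. Qed.

Lemma rnorm_real x : rnorm (x%:C%C) = `|x|.
Proof. by rewrite /rnorm normc_def /= expr0n /= addr0 sqrtr_sqr. Qed.

Lemma rnormMn (z : R[i]) k : rnorm (z *+ k) = rnorm z *+ k.
Proof.
rewrite -mulr_natr -[RHS]mulr_natr rnormM /rnorm normr_nat.
by rewrite -(rmorph_nat (real_complex R)).
Qed.

Lemma rnorm_sign (b : bool) : rnorm ((-1) ^+ b : R[i]) = 1.
Proof. by rewrite /rnorm normr_sign. Qed.

Lemma rnorm_sqr z : rnorm z ^+ 2 = complex.Re z ^+ 2 + complex.Im z ^+ 2.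
Proof. by rewrite /rnorm normc_def /= sqr_sqrtr// addr_ge0 ?sqr_ge0. Qed.

Lemma normr_Re z : `|complex.Re z| <= rnorm z.
Proof.
rewrite -ler_sqr ?nnegrE ?rnorm_ge0// rnorm_sqr real_normK ?num_real//.
by rewrite lerDl sqr_ge0.
Qed.

Lemma normr_Im z : `|complex.Im z| <= rnorm z.
Proof.
rewrite -ler_sqr ?nnegrE ?rnorm_ge0// rnorm_sqr real_normK ?num_real//.
by rewrite lerDr sqr_ge0.
Qed.

Lemma rnorm_leReIm z : rnorm z <= `|complex.Re z| + `|complex.Im z|.
Proof.
rewrite {1}[z]complexE; apply: le_trans (rnormD _ _) _.
by rewrite rnormM !rnorm_real {1}/rnorm normc_def /= expr0n add0r expr1n sqrtr1 mul1r.
Qed.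

End RnormC.

Section Diff.
Variables (R : realType) (n : nat) (X : normedModType R[i]).

Lemma differentiable_prod (I : Type) (s : seq I) (F : I -> 'rV[R[i]]_n -> R[i]) z :
  (forall i, differentiable (F i) z) ->
  differentiable (fun u => \prod_(i <- s) F i u) z.
Proof.
move=> dF; elim: s => [|i s IH].
  under [X in differentiable X _]funext do rewrite big_nil.
  exact: differentiable_cst.
under [X in differentiable X _]funext do rewrite big_cons.
exact: (@differentiableM _ _ (F i)).
Qed.

Lemma differentiable_sumr (I : Type) (s : seq I) (F : I -> 'rV[R[i]]_n -> X) z :
  (forall i, differentiable (F i) z) ->
  differentiable (fun u => \sum_(i <- s) F i u) z.
Proof.
move=> dF; elim: s => [|i s IH].
  under [X in differentiable X _]funext do rewrite big_nil.
  exact: differentiable_cst.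
under [X in differentiable X _]funext do rewrite big_cons.
exact: (@differentiableD _ _ _ (F i)).
Qed.

Lemma differentiable_monomial a (z : 'rV[R[i]]_n) :
  differentiable (fun u => monomial u a) z.
Proof.
apply: differentiable_prod => i.
(* Each power is written as a product of equal factors, so that the product rule above applies a
   second time. *)
under [X in differentiable X _]funext do rewrite -[a i]subn0 -prodr_const_nat.
by apply: differentiable_prod => _; exact: differentiable_coord.
Qed.

End Diff.

(** * Polynomials with random signs *)

Section Words.
Variables (n m : nat).
Implicit Types (w : {ffun 'I_m -> 'I_n}) (a : {ffun 'I_n -> nat}).

(** A word picks one summand from each of the m factors of (\sum_i F_i)^m; its type is the exponent
    of the resulting monomial. *)
Definition word_type w : {ffun 'I_n -> nat} := [ffun i => #|[pred j | w j == i]|].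

(* The multinomial coefficient m!/a! if |a| = m, and 0 otherwise. *)
Definition multinom a : nat := #|[pred w | word_type w == a]|.

(** These are the exponents of total degree m; taking them as types of words makes every [multinom]
    on the list positive. *)
Definition word_types : seq {ffun 'I_n -> nat} :=
  undup [seq word_type w | w : {ffun 'I_m -> 'I_n}].

Lemma prod_word (T : comPzSemiRingType) (F : 'I_n -> T) w :
  \prod_j F (w j) = \prod_i F i ^+ word_type w i.
Proof.
rewrite (partition_big w predT)//=; apply: eq_bigr => i _.
rewrite ffunE -prodr_const; apply: eq_big => j //= /eqP <-//.
Qed.

Lemma mem_word_types a : a \in word_types -> exists w, word_type w = a.
Proof. by rewrite mem_undup => /mapP[w _ ->]; exists w. Qed.

Lemma word_type_in w : word_type w \in word_types.
Proof. by rewrite mem_undup; apply/mapP; exists w; rewrite ?mem_enum. Qed.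

Lemma uniq_word_types : uniq word_types.
Proof. exact: undup_uniq. Qed.

Lemma multinom_gt0 a : a \in word_types -> (0 < multinom a)%N.
Proof.
by move=> /mem_word_types[w wa]; apply/card_gt0P; exists w; rewrite inE wa.
Qed.

(* Words of the same type as w only use the at most m letters of w. *)
Lemma multinom_le a : (multinom a <= m ^ m)%N.
Proof.
have [->//|/card_gt0P[w]] := posnP (multinom a).
rewrite inE => /eqP wa.
pose A := [set w j | j : 'I_m].
have cA : (#|A| <= m)%N by rewrite -[leqRHS](card_ord m) leq_imset_card.
apply: (@leq_trans (#|A| ^ #|'I_m|)); last first.
  rewrite card_ord; have [->//|m0] := posnP m.
  by rewrite leq_exp2r.
rewrite -card_ffun_on /multinom; apply: subset_leq_card.
apply/fintype.subsetP => v; rewrite inE => /eqP va.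
apply/ffun_onP => j; apply/imsetP.
have : (0 < word_type v (v j))%N.
  by rewrite ffunE; apply/card_gt0P; exists j; rewrite inE.
rewrite va -wa ffunE => /card_gt0P[k]; rewrite inE => /eqP wk.
by exists k.
Qed.

Lemma sum_words (V : nmodType) (G : {ffun 'I_n -> nat} -> V) :
  \sum_w G (word_type w) = \sum_(a <- word_types) G a *+ multinom a.
Proof.
under [RHS]eq_bigr do rewrite -sumr_const.
rewrite (exchange_big_dep predT)//=; apply: eq_bigr => w _.
rewrite big_mkcond /= (bigD1_seq (word_type w)) ?word_type_in ?uniq_word_types//=.
rewrite inE eqxx big1 ?addr0// => a; rewrite inE eq_sym.
by case: eqP.
Qed.

(** Distributivity expands the power into a sum over words, which is then grouped by type. *)
Lemma multinomial_sum (T : comPzSemiRingType) (F : 'I_n -> T) :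
  (\sum_i F i) ^+ m = \sum_(a <- word_types) (\prod_i F i ^+ a i) *+ multinom a.
Proof.
rewrite -sum_words -[in LHS](card_ord m) -prodr_const.
rewrite bigA_distr_bigA; apply: eq_bigr => w _; exact: prod_word.
Qed.

End Words.

(** * Choosing signs by averaging *)

Section Signs.
Variables (R : realType) (I : eqType) (K : finType).
Implicit Types (v : K -> I -> R) (c : K -> R) (e : I -> bool).

(* The average of the left-hand side over all signs is the right-hand side. *)
Lemma exists_signs_prod (s : seq I) v c : uniq s ->
  exists e, \sum_k c k * \prod_(i <- s) (1 + (-1) ^+ e i * v k i) <= \sum_k c k.
Proof.
elim: s c => [|i s IH] c /=.
  by exists (fun=> true); under eq_bigr do rewrite big_nil mulr1.
case/andP => iNs us.
(* The values for the two signs at [i] add up to twice \sum_k c_k, so one of them is small enough.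
   Its factor then joins the weights for the remaining indices, which is why [c] is general in the
   induction. *)
have [b hb] : exists b : bool, \sum_k c k * (1 + (-1) ^+ b * v k i) <= \sum_k c k.
  have h : \sum_k c k * (1 + (-1) ^+ false * v k i) +
      \sum_k c k * (1 + (-1) ^+ true * v k i) = \sum_k c k + \sum_k c k.
    rewrite -!big_split; apply: eq_bigr => k _ /=; rewrite expr0 expr1; ring.
  have [h0|h0] := leP (\sum_k c k * (1 + (-1) ^+ false * v k i)) (\sum_k c k).
    by exists false.
  by exists true; move: h h0; lra.
have [e he] := IH (fun k => c k * (1 + (-1) ^+ b * v k i)) us.
exists (fun j => if j == i then b else e j).
apply: le_trans hb; apply: le_trans he; rewrite le_eqVlt; apply/orP; left.
apply/eqP/eq_bigr => k _; rewrite big_cons eqxx mulrA; congr (_ * _).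
by apply: eq_big_seq => j js; case: eqP => // ji; rewrite -ji js in iNs.
Qed.

(** Invert exp(2x^2 - x) >= 1 + 2x^2 - x and use (1 + x)(1 + 2x^2 - x) = 1 + x^2 (1 + 2x) >= 1. *)
Lemma expR_le1D (x : R) : `|x| <= 2^-1 -> expR (x - 2 * x ^+ 2) <= 1 + x.
Proof.
rewrite ler_norml => /andP[x1 x2].
have d0 : 0 < 1 + (2 * x ^+ 2 - x) by nra.
have h := expR_ge1Dx (2 * x ^+ 2 - x).
rewrite -[x - _]opprB expRN -ler_pV2 ?inE ?unitfE; last 2 first.
- by apply/andP; split; [apply: lt0r_neq0|]; lra.
- by apply/andP; split; rewrite ?invr_eq0 ?invr_gt0 ?gt_eqF ?expR_gt0.
rewrite invrK; apply: le_trans h; rewrite -div1r ler_pdivrMr; nra.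
Qed.

(** A union bound: with unit weights the products sum to at most #|K|, and they are nonnegative, so
    each is at most #|K|. By [expR_le1D] each product is at least exp(x - 2), where x is the signed
    sum; logarithms finish. *)
Lemma exists_signs (s : seq I) v : uniq s ->
  (forall k i, i \in s -> `|v k i| <= 2^-1) ->
  (forall k, \sum_(i <- s) v k i ^+ 2 <= 1) ->
  exists e, forall k, \sum_(i <- s) (-1) ^+ e i * v k i <= ln #|K|%:R + 2.
Proof.
move=> us vle sle.
have [e he] := exists_signs_prod v (fun=> 1) us.
exists e => k.
have ge0 j : 0 <= \prod_(i <- s) (1 + (-1) ^+ e i * v j i).
  rewrite big_seq; apply: prodr_ge0 => i /(vle j).
  by rewrite ler_norml; case: (e i); rewrite ?expr0 ?expr1; lra.
have : \prod_(i <- s) (1 + (-1) ^+ e i * v k i) <= #|K|%:R.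
  apply: (@le_trans _ _ (\sum_(j : K) 1)); last by rewrite sumr_const.
  apply: le_trans he; rewrite (bigD1 k)//= mul1r lerDl sumr_ge0// => j _.
  by rewrite mul1r.
set x := \sum_(i <- s) (-1) ^+ e i * v k i => hp.
have K0 : 0 < #|K|%:R :> R by rewrite ltr0n; apply/card_gt0P; exists k.
have : expR (x - 2) <= #|K|%:R.
  apply: le_trans hp.
  apply: (@le_trans _ _ (expR (\sum_(i <- s) ((-1) ^+ e i * v k i - 2 * v k i ^+ 2)))).
    by rewrite ler_expR sumrB -mulr_sumr; have := sle k; rewrite /x; lra.
  rewrite expR_sum big_seq [leRHS]big_seq; apply: ler_prod => i /(vle k) vi.
  rewrite expR_ge0 /=; have -> : v k i ^+ 2 = ((-1) ^+ e i * v k i) ^+ 2.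
    by rewrite exprMn sqrr_sign mul1r.
  by apply: expR_le1D; rewrite normrM normr_sign mul1r.
rewrite -ler_ln ?posrE ?expR_gt0// expRK; lra.
Qed.

End Signs.

Lemma powR_prod (R : realType) (I : Type) (r : seq I) (P : pred I) (F : I -> R) (s : R) :
  (forall i, P i -> 0 <= F i) ->
  (\prod_(i <- r | P i) F i) `^ s = \prod_(i <- r | P i) F i `^ s.
Proof.
move=> F0; elim: r => [|i r IH]; first by rewrite !big_nil powR1.
rewrite !big_cons; case: ifP => // Pi.
by rewrite powRM ?F0 ?prodr_ge0// IH.
Qed.

Lemma powR_exprn (R : realType) (x s : R) (k : nat) :
  0 <= x -> (x ^+ k) `^ s = (x `^ s) ^+ k.
Proof.
move=> x0; elim: k => [|k IH]; first by rewrite !expr0 powR1.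
by rewrite !exprS powRM ?exprn_ge0// IH.
Qed.

(** * Rounding, perturbation of products, and the square sum of the coefficients *)

Section Estimates.
Variables (R : realType) (n m : nat).

(** Rounding toward zero, rather than to the nearest grid point, never increases the modulus, so a
    rounded point of a ball stays in it. The index is shifted by [N] to cover [-1, 1]. *)
Lemma round_toward_zero (N : nat) (x : R) : (0 < N)%N -> `|x| <= 1 ->
  exists k : 'I_N.*2.+1, let y := (k%:R - N%:R) / N%:R in
    `|y| <= `|x| /\ `|x - y| <= N%:R^-1.
Proof.
move=> N0 x1; have N0' : 0 < N%:R :> R by rewrite ltr0n.
have h0 : 0 <= N%:R * `|x| by rewrite mulr_ge0.
have /andP[t1 t2] := Num.Theory.truncn_itv h0.
set t := Num.Def.trunc _ in t1 t2.
have tN : (t <= N)%N.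
  by rewrite -(ler_nat R); apply: le_trans t1 _; rewrite ler_piMr.
have y1 : t%:R / N%:R <= `|x| by rewrite ler_pdivrMr// mulrC.
have y2 : `|x| - t%:R / N%:R <= N%:R^-1.
  rewrite -[leRHS]div1r lerBlDl -mulrDl ler_pdivlMr// natr1 mulrC; exact: ltW.
have y0 : 0 <= t%:R / N%:R :> R by rewrite divr_ge0.
have [x0|x0] := leP 0 x.
  have kP : (N + t < N.*2.+1)%N by rewrite ltnS -addnn leq_add2l.
  exists (Ordinal kP) => /=; rewrite natrD addrAC subrr add0r.
  rewrite (ger0_norm x0) in y1 y2 *.
  by rewrite (ger0_norm y0) ger0_norm// subr_ge0.
have kP : (N - t < N.*2.+1)%N by rewrite ltnS -addnn (leq_trans (leq_subr _ _)) ?leq_addr.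
exists (Ordinal kP) => /=; rewrite natrB// addrAC subrr add0r mulNr normrN.
rewrite (ltr0_norm x0) in y1 y2 *; rewrite (ger0_norm y0); split => //.
by rewrite ler0_norm; lra.
Qed.

(** The factors are exchanged one at a time, and each exchange costs at most [d]. *)
Lemma rnorm_prodB_le (I : Type) (s : seq I) (u v : I -> R[i]) (d : R) :
  (forall i, rnorm (u i) <= 1) -> (forall i, rnorm (v i) <= 1) ->
  (forall i, rnorm (u i - v i) <= d) ->
  rnorm (\prod_(i <- s) u i - \prod_(i <- s) v i) <= (size s)%:R * d.
Proof.
move=> u1 v1 uv; elim: s => [|i s IH]; first by rewrite !big_nil subrr rnorm0 mul0r.
rewrite !big_cons /= -natr1 mulrDl mul1r.
set A := \prod_(_ <- _) _ in IH *; set B := \prod_(_ <- _) _ in IH *.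
have -> : u i * A - v i * B = u i * (A - B) + (u i - v i) * B by ring.
apply: le_trans (rnormD _ _) _; rewrite !rnormM lerD//.
  by apply: le_trans IH; rewrite ler_piMl ?rnorm_ge0.
apply: le_trans (uv i); rewrite ler_piMr ?rnorm_ge0//.
by rewrite /B rnorm_prod; apply: prodr_ile1 => j _; rewrite rnorm_ge0 v1.
Qed.

(** Let y_a be the term that is squared. Since m!/a! <= m^m, y_a^s is at most (m!/a!) \prod_i u_i^(s
    a_i), and these sum to (\sum_i u_i^s)^m <= 1. Hence y_a <= 1, and s <= 2 gives y_a^2 <=
    y_a^s. *)
Lemma sum_sqr_multinom_le (s : R) (u : 'I_n -> R) : 1 <= s <= 2 ->
  (forall i, 0 <= u i) -> \sum_i u i `^ s <= 1 ->
  \sum_(a <- word_types n m)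
    ((\prod_i u i ^+ a i) *+ multinom m a / (m ^ m)%:R `^ (1 - s^-1)) ^+ 2 <= 1.
Proof.
move=> /andP[s1 s2] u0 us.
have s0 : 0 < s by lra.
have M1 : 1 <= (m ^ m)%:R :> R by rewrite ler1n expn_gt0; case: (m).
have M0 : 0 < (m ^ m)%:R :> R by lra.
have hs : \sum_(a <- word_types n m) (\prod_i (u i `^ s) ^+ a i) *+ multinom m a <= 1.
  by rewrite -multinomial_sum exprn_ile1// sumr_ge0// => i _; rewrite powR_ge0.
pose y (a : {ffun 'I_n -> nat}) : R :=
  (\prod_i u i ^+ a i) *+ multinom m a / (m ^ m)%:R `^ (1 - s^-1).
have x0 (a : {ffun 'I_n -> nat}) : 0 <= \prod_i u i ^+ a i.
  by apply: prodr_ge0 => i _; rewrite exprn_ge0.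
have y0 a : 0 <= y a by rewrite divr_ge0 ?powR_ge0// mulrn_wge0.
have t0 (a : {ffun 'I_n -> nat}) : 0 <= (\prod_i (u i `^ s) ^+ a i) *+ multinom m a.
  by rewrite mulrn_wge0// prodr_ge0// => i _; rewrite exprn_ge0// powR_ge0.
have ys a : a \in word_types n m ->
    y a `^ s <= (\prod_i (u i `^ s) ^+ a i) *+ multinom m a.
  move=> aw; have c0 : 0 < (multinom m a)%:R :> R by rewrite ltr0n multinom_gt0.
  have sE : (\prod_i u i ^+ a i) `^ s = \prod_i (u i `^ s) ^+ a i.
    rewrite powR_prod => [|i _]; last by rewrite exprn_ge0.
    by apply: eq_bigr => i _; exact: powR_exprn.
  rewrite /y -[X in X / _]mulr_natl powRM ?invr_ge0 ?powR_ge0 ?mulr_ge0//.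
  rewrite powRM// sE -[leRHS]mulr_natl mulrAC ler_wpM2r//.
    by rewrite -sE powR_ge0.
  rewrite -powR_inv1 ?powR_ge0// -!powRrM.
  have -> : (1 - s^-1) * (-1 * s) = - (s - 1) by field; rewrite gt_eqF.
  rewrite powRN ler_pdivrMr ?powR_gt0// mulrC.
  have -> : (multinom m a)%:R `^ s =
      (multinom m a)%:R `^ (s - 1) * (multinom m a)%:R :> R.
    by rewrite -[X in _ * X]powRr1 ?ltW// -powRD ?subrK// (gt_eqF c0) implybT.
  apply: ler_wpM2r; first exact: ltW.
  apply: ge0_ler_powR; rewrite ?nnegrE ?subr_ge0 ?ler_nat ?multinom_le//; exact: ltW.
apply: (le_trans _ hs); rewrite big_seq [leRHS]big_seq; apply: ler_sum => a aw.
apply: le_trans (ys a aw); rewrite -/(y a).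
have y1 : y a `^ s <= 1.
  apply: le_trans (ys a aw) _; apply: (le_trans _ hs).
  rewrite (bigD1_seq a) ?uniq_word_types//= lerDl sumr_ge0// => b _; exact: t0.
have [->|yn0] := eqVneq (y a) 0; first by rewrite expr0n powR_ge0.
have yp : 0 < y a by rewrite lt0r yn0 y0.
rewrite -powR_mulrn// ger_powR// yp /=.
rewrite leNgt; apply/negP => y1'.
move: y1; rewrite leNgt => /negP; apply.
have -> : 1 = 1 `^ s :> R by rewrite powR1.
by apply: gt0_ltr_powR; rewrite ?nnegrE.
Qed.

End Estimates.

(** * Signed polynomials at finitely many points *)

Section SignedPoly.
Variables (R : realType) (n m : nat).
Implicit Types (u v : 'I_n -> R[i]) (e : {ffun 'I_n -> nat} -> bool).

Definition signed_poly e u : R[i] :=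
  \sum_(a <- word_types n m) (-1) ^+ e a * ((\prod_i u i ^+ a i) *+ multinom m a).

(** Over words all coefficients are +-1 and every term has exactly m factors, which suits
    perturbation and homogeneity. *)
Lemma signed_polyE e u :
  signed_poly e u =
  \sum_(w : {ffun 'I_m -> 'I_n}) (-1) ^+ e (word_type w) * \prod_j u (w j).
Proof.
under [RHS]eq_bigr do rewrite prod_word.
rewrite (sum_words m (fun a => (-1) ^+ e a * \prod_i u i ^+ a i)).
by apply: eq_bigr => a _; rewrite mulrnAr.
Qed.

(** There are n^m words, and each contributes at most m d by [rnorm_prodB_le]. *)
Lemma signed_polyB_le e u v (d : R) : (forall i, rnorm (u i) <= 1) ->
  (forall i, rnorm (v i) <= 1) -> (forall i, rnorm (u i - v i) <= d) ->
  rnorm (signed_poly e u - signed_poly e v) <= (n ^ m)%:R * (m%:R * d).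
Proof.
move=> u1 v1 uv; rewrite !signed_polyE -sumrB.
apply: le_trans (rnorm_sum _ _ _) _.
apply: (@le_trans _ _ (\sum_(w : {ffun 'I_m -> 'I_n}) m%:R * d)); last first.
  by rewrite sumr_const card_ffun !card_ord -[leLHS]mulr_natl.
apply: ler_sum => w _; rewrite -mulrBr rnormM rnorm_sign mul1r.
have := @rnorm_prodB_le R 'I_m (index_enum _) (u \o w) (v \o w) d.
by rewrite [index_enum _]unlock -enumT size_enum_ord; apply=> j; rewrite /= ?u1 ?v1 ?uv.
Qed.

(** [exists_signs] controls 4 #|K| real sums at once: real and imaginary parts at each point, each
    bounded from both sides. Adding the bounds for the two parts turns the factor 2 into 4. *)
Lemma exists_signed_poly_le (s : R) (K : finType) (u : K -> 'I_n -> R[i]) :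
  1 <= s <= 2 -> (forall k, \sum_i rnorm (u k i) `^ s <= 1) ->
  exists e, forall k, rnorm (signed_poly e (u k)) <=
    4 * (ln (#|K| * 4)%:R + 2) * (m ^ m)%:R `^ (1 - s^-1).
Proof.
move=> s12 us; set sig := (m ^ m)%:R `^ _.
have sig0 : 0 < sig by rewrite powR_gt0// ltr0n expn_gt0; case: (m).
pose c k (a : {ffun 'I_n -> nat}) : R[i] := (\prod_i u k i ^+ a i) *+ multinom m a.
pose part (b : bool) : R[i] -> R := if b then @complex.Re R else @complex.Im R.
(* The first boolean selects the real or imaginary part, the second the side of the bound. Dividing
   by 2 [sig] makes the entries at most 1/2, as [exists_signs] requires. *)
pose v (k : K * bool * bool) (a : {ffun 'I_n -> nat}) : R :=
  (-1) ^+ k.2 * (part k.1.2 (c k.1.1 a) / (2 * sig)).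
have partD b : {morph part b : x y / x + y}.
  by case: b => -[? ?] [? ?].
have part0 b : part b 0 = 0 by case: b.
have partS b (b' : bool) x : part b ((-1) ^+ b' * x) = (-1) ^+ b' * part b x.
  by case: b'; case: b; rewrite ?expr0 ?expr1 ?mul1r// !mulN1r; case: x.
have part_le b x : `|part b x| <= rnorm x.
  by case: b; [exact: normr_Re|exact: normr_Im].
have S1 k : \sum_(a <- word_types n m) (rnorm (c k a) / sig) ^+ 2 <= 1.
  have := @sum_sqr_multinom_le R n m s (fun i => rnorm (u k i)) s12
    (fun i => rnorm_ge0 _) (us k).
  apply: le_trans; rewrite le_eqVlt; apply/orP; left; apply/eqP.
  apply: eq_bigr => a _; rewrite /c rnormMn rnorm_prod.
  by congr ((_ *+ _ / _) ^+ _); apply: eq_bigr => i _; rewrite rnormX.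
have y0 k a : 0 <= rnorm (c k a) / sig by rewrite divr_ge0 ?rnorm_ge0// ltW.
have vle k a : `|v k a| <= rnorm (c k.1.1 a) / sig / 2.
  rewrite /v normrM normr_sign mul1r normrM.
  have sV0 : 0 <= (2 * sig)^-1 by rewrite invr_ge0 mulr_ge0// ltW.
  rewrite (ger0_norm sV0).
  rewrite invfM [2^-1 / sig]mulrC mulrA.
  by do 2![apply: ler_wpM2r; rewrite ?invr_ge0 ?(ltW sig0)//].
have [||e he] := @exists_signs R _ (K * bool * bool)%type _ v (uniq_word_types n m).
- move=> k a aw; apply: le_trans (vle k a) _.
  rewrite ler_pdivrMr// mulVf// -(expr_le1 (n := 2))//.
  apply: le_trans (S1 k.1.1); rewrite (bigD1_seq a) ?uniq_word_types//= lerDl.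
  by apply: sumr_ge0 => b _; exact: sqr_ge0.
- move=> k; apply: le_trans (S1 k.1.1); apply: ler_sum => a _.
  rewrite -[leLHS]real_normK ?num_real// ler_sqr ?nnegrE//.
  by apply: le_trans (vle k a) _; rewrite ler_pdivrMr// ler_peMr// ler1n.
exists e => k.
rewrite !card_prod card_bool -mulnA in he.
have hp b : `|part b (signed_poly e (u k))| <= 2 * (ln (#|K| * 4)%:R + 2) * sig.
  have E b' : \sum_(a <- word_types n m) (-1) ^+ e a * v (k, b, b') a =
      (-1) ^+ b' * part b (signed_poly e (u k)) / (2 * sig).
    rewrite /signed_poly (big_morph _ (partD b) (part0 b)) mulr_sumr mulr_suml.
    by apply: eq_bigr => a _; rewrite partS /v /= -/(c k a); ring.
  have := he (k, b, true); have := he (k, b, false).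
  rewrite !E expr0 expr1 mul1r mulN1r !ler_pdivrMr ?mulr_gt0//.
  rewrite ler_norml; lra.
apply: le_trans (rnorm_leReIm _) _.
have := hp true; have := hp false; rewrite /part; lra.
Qed.

End SignedPoly.

(** * From a grid to the whole ball: a Kahane-Salem-Zygmund type bound *)

Section KSZ.
Variables (R : realType) (n m : nat).

Lemma le1_of_powR_le1 (x s : R) : 0 < s -> 0 <= x -> x `^ s <= 1 -> x <= 1.
Proof.
move=> s0 x0; rewrite leNgt => xs; rewrite leNgt; apply: contra xs => x1.
have -> : 1 = 1 `^ s :> R by rewrite powR1.
by apply: gt0_ltr_powR; rewrite ?nnegrE.
Qed.

Lemma ln_le_id (x : R) : 0 < x -> ln x <= x.
Proof.
move=> x0; have -> : x = 1 + (x - 1) by ring.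
by apply: le_trans (le_ln1Dx _) _; lra.
Qed.

(** The grid has at most (5 m n^m)^(2n) points, and ln x <= x makes its logarithm polynomial in m
    and n. The summand 1 leaves room for the rounding error. *)
Lemma ln_grid_card_le : (0 < n)%N -> (0 < m)%N ->
  let J := 'I_(2 * m * n ^ m).*2.+1 in
  4 * (ln (#|{ffun 'I_n -> J * J}| * 4)%:R + 2) + 1 <= (100 * m * n ^ 2)%:R :> R.
Proof.
move=> n0 m0; cbv zeta; rewrite card_ffun card_prod !card_ord.
set N := (_ * _ ^ _)%N.
have N5 : (N.*2.+1 <= 5 * (m * n ^ m))%N.
  have : (0 < m * n ^ m)%N by rewrite muln_gt0 m0 expn_gt0 n0.
  rewrite /N -mulnA -muln2 mulnAC -[5%N]/(2 * 2 + 1)%N mulnDl mul1n.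
  by move=> k0; rewrite -[X in (X < _)%N]addn0 ltn_add2l.
have n1 : 1 <= n%:R :> R by rewrite ler1n.
have m1 : 1 <= m%:R :> R by rewrite ler1n.
have l1 : ln N.*2.+1%:R <= 5 + (m%:R + m%:R * n%:R) :> R.
  apply: (@le_trans _ _ (ln (5 * (m * n ^ m))%:R)).
    by rewrite ler_ln ?posrE ?ltr0n ?ler_nat// muln_gt0 /= muln_gt0 m0 expn_gt0 n0.
  rewrite natrM lnM ?posrE ?ltr0n ?muln_gt0 ?m0 ?expn_gt0 ?n0//.
  rewrite natrM lnM ?posrE ?ltr0n ?expn_gt0 ?n0//.
  rewrite natrX lnXn ?ltr0n// -[ln n%:R *+ m]mulr_natl; apply: lerD; first exact: ln_le_id.
  apply: lerD; first by apply: ln_le_id; lra.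
  by apply: ler_wpM2l; [lra|apply: ln_le_id; lra].
rewrite natrM lnM ?posrE ?ltr0n ?expn_gt0 ?muln_gt0// natrX lnXn ?ltr0n ?muln_gt0//.
rewrite natrM lnM ?posrE ?ltr0n// -[_ *+ n]mulr_natl !natrM.
have := @ln_le_id 4 (ltr0Sn _ _); move: l1; set L := ln _; set L4 := ln _ => l1 l4.
have : n%:R * (L + L) <= n%:R * (2 * (5 + (m%:R + m%:R * n%:R))).
  by apply: ler_wpM2l; lra.
have nm : m%:R <= m%:R * n%:R :> R by rewrite ler_peMr//; lra.
have nn : m%:R * n%:R <= m%:R * (n%:R * n%:R) :> R by rewrite ler_pM2l ?ler_peMr//; lra.
have nm' : n%:R <= m%:R * n%:R :> R by rewrite ler_peMl//; lra.
have -> : n%:R * (2 * (5 + (m%:R + m%:R * n%:R))) =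
  10 * n%:R + 2 * (m%:R * n%:R) + 2 * (m%:R * (n%:R * n%:R)) :> R by ring.
lra.
Qed.

(** Signs are chosen for the grid points of the ball. Any other point rounds to one of these, at a
    cost of at most 1, which is absorbed because (m^m)^(1 - 1/s) >= 1. *)
Lemma exists_signed_poly_bound (s : R) : 1 <= s <= 2 -> (0 < n)%N -> (0 < m)%N ->
  exists e, forall u : 'I_n -> R[i], \sum_i rnorm (u i) `^ s <= 1 ->
    rnorm (signed_poly m e u) <= (100 * m * n ^ 2)%:R * (m ^ m)%:R `^ (1 - s^-1).
Proof.
move=> s12 n0 m0; have s0 : 0 < s by lra.
(* The mesh is so fine that rounding changes the polynomial by at most 1. *)
set N := (2 * m * n ^ m)%N; have N0 : (0 < N)%N by rewrite !muln_gt0 m0 expn_gt0 n0.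
set J := 'I_N.*2.+1.
pose g (k : J) : R := (k%:R - N%:R) / N%:R.
pose w (k : {ffun 'I_n -> J * J}) i : R[i] := Complex (g (k i).1) (g (k i).2).
(* Grid points outside the ball are replaced by the origin, so that the whole finite type can index
   the points. *)
pose w' (k : {ffun 'I_n -> J * J}) :=
  if \sum_i rnorm (w k i) `^ s <= 1 then w k else fun=> 0.
have [|e he] := @exists_signed_poly_le R n m s {ffun 'I_n -> J * J} w' s12.
  move=> k; rewrite /w'; case: ifP => // _; rewrite big1// => i _.
  by rewrite rnorm0 powR0// gt_eqF.
exists e => u us.
have u1 i : rnorm (u i) <= 1.
  apply: (le1_of_powR_le1 s0 (rnorm_ge0 _)); apply: le_trans us.
  by rewrite (bigD1 i)//= lerDl sumr_ge0// => j _; rewrite powR_ge0.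
have /fin_all_exists[k hk] i : exists k : J * J,
    (`|g k.1| <= `|complex.Re (u i)| /\ `|complex.Re (u i) - g k.1| <= N%:R^-1) /\
    (`|g k.2| <= `|complex.Im (u i)| /\ `|complex.Im (u i) - g k.2| <= N%:R^-1).
  have [a ha] := round_toward_zero N0 (le_trans (normr_Re _) (u1 i)).
  have [b hb] := round_toward_zero N0 (le_trans (normr_Im _) (u1 i)).
  by exists (a, b).
pose kf := [ffun i => k i].
have wu i : rnorm (w kf i) <= rnorm (u i).
  rewrite -ler_sqr ?nnegrE ?rnorm_ge0// !rnorm_sqr /= ffunE.
  have [[h1 _] [h2 _]] := hk i.
  apply: lerD; rewrite -[leLHS]real_normK ?num_real//.
    by rewrite -[leRHS]real_normK ?num_real// ler_sqr ?nnegrE.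
  by rewrite -[leRHS]real_normK ?num_real// ler_sqr ?nnegrE.
have ws : \sum_i rnorm (w kf i) `^ s <= 1.
  apply: (le_trans _ us); apply: ler_sum => i _.
  by apply: ge0_ler_powR; rewrite ?nnegrE ?rnorm_ge0 ?(ltW s0).
have uw i : rnorm (u i - w kf i) <= 2 / N%:R.
  apply: le_trans (rnorm_leReIm _) _.
  have [[_ h1] [_ h2]] := hk i; rewrite /w ffunE.
  case: (u i) h1 h2 => x y /=; lra.
have := signed_polyB_le m e u1 (fun i => le_trans (wu i) (u1 i)) uw.
have := he kf; rewrite /w' ws.
set P := signed_poly m e u; set Q := signed_poly m e _ => hQ hPQ.
have sig1 : 1 <= (m ^ m)%:R `^ (1 - s^-1) :> R.
  rewrite -[leLHS](powRr0 (m ^ m)%:R); apply: ler_powR.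
    by rewrite ler1n expn_gt0 m0.
  by rewrite subr_ge0 invf_le1//; lra.
have hPQ1 : rnorm (P - Q) <= 1.
  apply: le_trans hPQ _; rewrite mulrA -natrM mulrA ler_pdivrMr ?ltr0n//.
  rewrite mul1r -natrM ler_nat /N.
  by rewrite mulnC mulnA mulnAC mulnC.
apply: le_trans (ler_wpM2r (powR_ge0 _ _) (ln_grid_card_le n0 m0)).
rewrite mulrDl mul1r -/N.
have -> : P = Q + (P - Q) by ring.
by apply: le_trans (rnormD _ _) _; apply: lerD => //; lra.
Qed.

End KSZ.

(** * Bohr radii *)

Section Admissible.
Variables (R : realType) (n m : nat) (X : completeNormedModType R[i]).
Variables (e : {ffun 'I_n -> nat} -> bool) (v : X).

Definition signed_fun (z : 'rV[R[i]]_n) : X := signed_poly m e (fun i => z 0 i) *: v.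

Definition signed_coeff (a : {ffun 'I_n -> nat}) : X :=
  ((-1) ^+ e a *+ multinom m a) *: v.

Lemma signed_funE z :
  signed_fun z = \sum_(a <- word_types n m) monomial z a *: signed_coeff a.
Proof.
rewrite /signed_fun /signed_poly scaler_suml; apply: eq_bigr => a _.
by rewrite /signed_coeff scalerA /monomial mulrnAr mulrnAr mulrC.
Qed.

Lemma signed_fun_holomorphic Omega : holomorphic_on Omega signed_fun.
Proof.
move=> z _; rewrite (funext signed_funE : signed_fun = _).
apply: differentiable_sumr => a; apply: differentiableZl.
exact: differentiable_monomial.
Qed.

(** [multinom] vanishes off [word_types], so the partial sums are constant once they contain these
    exponents. *)
Lemma signed_coeffP Omega : monomial_coeffs Omega signed_fun signed_coeff.
Proof.
move=> z _.
suff h : \forall A \near totally,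
    partial_sum (fun a => monomial z a *: signed_coeff a) A = signed_fun z.
  apply: (@cvg_near_cst _ X (signed_fun z) _ totally _ h).
  exact: (@filter_filter _ _ totally_filter).
exists [fset a in word_types n m]%fset => // A /= sA.
rewrite /partial_sum.
rewrite -(big_seq_fsetE _ _ predT (fun a => monomial z a *: signed_coeff a)) /=.
rewrite signed_funE -(big_fset_incl _ sA); last first.
  move=> a _; rewrite !inE => aN; rewrite /signed_coeff.
  suff -> : multinom m a = 0%N by rewrite mulr0n scale0r scaler0.
  apply/eqP; rewrite -leqn0 leqNgt; apply: contra aN => /card_gt0P[w].
  by rewrite inE => /eqP <-; rewrite word_type_in.
apply: perm_big; apply: uniq_perm; rewrite ?uniq_word_types ?fset_uniq//.
by move=> a; rewrite !inE.
Qed.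

(** Test admissibility on [signed_fun] and keep the terms of [word_types]. As m!/a! >= 1 and p >= 1,
    (m!/a!)^p >= m!/a!, so these terms dominate the multinomial expansion; the norm of [v]
    cancels. *)
Lemma arith_admissible_le Omega (p lambda M : R) (r : 'I_n -> R) :
  v != 0 -> 1 <= p -> 0 <= lambda -> Omega 0 -> (forall i, 0 <= r i) ->
  (forall z : 'rV[R[i]]_n, Omega z -> rnorm (signed_poly m e (fun i => z 0 i)) <= M) ->
  arith_bohr_admissible X Omega p lambda r ->
  (\sum_i r i `^ p) ^+ m <= lambda * M `^ p.
Proof.
move=> v0 p1 l0 O0 r0 PM adm.
have nv0 : 0 < rnorm v by rewrite lt0r rnorm_eq0 v0 rnorm_ge0.
have M0 : 0 <= M by apply: le_trans (PM _ O0); rewrite rnorm_ge0.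
have sup_le : (sup_norm Omega signed_fun <= (M * rnorm v)%:E)%E.
  apply: ge_ereal_sup => _ [z Oz <-].
  by rewrite lee_fin /signed_fun rnormZ ler_wpM2r ?rnorm_ge0// PM.
have sup_ge0 : (0 <= sup_norm Omega signed_fun)%E.
  apply: (@le_trans _ _ (rnorm (signed_fun 0))%:E); first by rewrite lee_fin rnorm_ge0.
  by apply: ereal_sup_ubound; exists 0.
have := adm _ _ (signed_fun_holomorphic (Omega := Omega)) _
  (signed_coeffP (Omega := Omega)).
move=> /(_ (le_lt_trans sup_le (ltry _))) H.
have {H}: (\esum_(a in [set: {ffun 'I_n -> nat}])
    (rnorm (signed_coeff a) `^ p * \prod_(i < n) r i `^ (p * (a i)%:R))%:E
    <= (lambda * (M * rnorm v) `^ p)%:E)%E.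
  apply: le_trans H _; rewrite EFinM lee_wpmul2l ?lee_fin//.
  rewrite -poweR_EFin; apply: gt0_ler_poweR; rewrite ?in_itv/= ?leey ?andbT//.
    by lra.
  by rewrite lee_fin mulr_ge0// ltW.
set S := (\esum_(a in _) _)%E => H.
have : ((\sum_(a <- word_types n m)
    rnorm (signed_coeff a) `^ p * \prod_(i < n) r i `^ (p * (a i)%:R))%:E <= S)%E.
  apply: esum_ge; exists [set` word_types n m]%classic.
    by split => //; exact: finite_seq.
  by rewrite -fsbig_seq ?uniq_word_types// sumEFin.
move=> /le_trans /(_ H) {H}; rewrite lee_fin => H.
rewrite -(ler_pM2r (powR_gt0 p nv0)) -mulrA -powRM ?rnorm_ge0//.
apply: le_trans H.
rewrite multinomial_sum mulr_suml big_seq [leRHS]big_seq; apply: ler_sum => a aw.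
rewrite /signed_coeff rnormZ rnormMn rnorm_sign.
rewrite powRM ?rnorm_ge0// mulrAC ler_wpM2r ?powR_ge0//.
have -> : \prod_(i < n) r i `^ (p * (a i)%:R) = \prod_(i < n) (r i `^ p) ^+ a i.
  by apply: eq_bigr => i _; rewrite powRrM powR_mulrn ?powR_ge0.
rewrite -[leLHS]mulr_natl ler_wpM2r//.
  by apply: prodr_ge0 => i _; rewrite exprn_ge0// powR_ge0.
by rewrite le1r_powR// ler1n multinom_gt0.
Qed.

End Admissible.

(** * Power means and extraction of roots *)

Section Numerics.
Variable R : realType.

(** With a the mean, sum Young's inequality for the products r_i a^(p-1): the left side becomes n
    a^p, and n a^p (1 - 1/p) cancels from the right. *)
Lemma powR_mean_le (n : nat) (r : 'I_n -> R) (p : R) : (0 < n)%N -> 1 <= p ->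
  (forall i, 0 <= r i) ->
  n%:R * (n%:R^-1 * \sum_i r i) `^ p <= \sum_i r i `^ p.
Proof.
move=> n0 p1 r0; have n0' : 0 < n%:R :> R by rewrite ltr0n.
set a := _ * \sum_i _.
have a0 : 0 <= a by rewrite mulr_ge0 ?invr_ge0// sumr_ge0.
have aE : \sum_i r i = n%:R * a by rewrite mulrA mulfV ?mul1r// gt_eqF.
(* The conjugate exponent p/(p - 1) exists only for p > 1. *)
have [p1'|p1'] := eqVneq p 1.
  by rewrite p1' powRr1// -aE; apply: ler_sum => i _; rewrite powRr1.
have {p1 p1'} p1 : 1 < p by rewrite lt_neqAle eq_sym p1'.
have p0 : 0 < p by lra.
have Young i : a `^ (p - 1) * r i <= r i `^ p / p + a `^ p * (1 - p^-1).
  rewrite mulrC.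
  have p0' : 0 < p / (p - 1) by rewrite divr_gt0//; lra.
  have := @conjugate_powR R _ _ p (p / (p - 1)) (r0 i) (powR_ge0 a (p - 1)) p0 p0'.
  have -> : p^-1 + (p / (p - 1))^-1 = 1 by field; rewrite !gt_eqF//; lra.
  move=> /(_ erefl) /le_trans; apply; rewrite -powRrM.
  have -> : (p - 1) * (p / (p - 1)) = p by field; rewrite gt_eqF//; lra.
  rewrite lerD2l le_eqVlt; apply/orP; left; apply/eqP; congr (_ * _).
  by field; rewrite !gt_eqF//; lra.
have : \sum_i a `^ (p - 1) * r i <= \sum_i (r i `^ p / p + a `^ p * (1 - p^-1)).
  by apply: ler_sum => i _; exact: Young.
rewrite -mulr_sumr aE big_split /= -mulr_suml sumr_const card_ord -[(_ * _) *+ n]mulr_natl.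
have -> : a `^ (p - 1) * (n%:R * a) = n%:R * a `^ p.
  by rewrite -[in RHS](mulr_powRB1 a0 p0); ring.
move=> h; rewrite -(ler_pM2r (_ : 0 < p^-1)) ?invr_gt0//.
move: h; rewrite mulrBr mulr1 -lerBlDr; set x := _ `^ p; set y := \sum_i _.
have -> : n%:R * x - n%:R * (x - x / p) = n%:R * x / p by ring.
by [].
Qed.

(** Apply the hypothesis with m the integer part of ln n plus 1, then take p-th and m-th roots. The
    constant is 600 = 100 * 2 * 3, with 2 from m^(1/m) <= 2 and 3 from m <= 3 ln n. *)
Lemma root_bound (n : nat) (a p lambda rho theta : R) : (1 < n)%N -> 0 <= a ->
  1 <= p -> 1 <= lambda -> 0 <= rho -> 0 <= theta <= 1 ->
  (forall m, (0 < m)%N ->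
     (n%:R * a `^ p) ^+ m <=
     lambda * (rho ^+ m * ((100 * m * n ^ 2)%:R * (m ^ m)%:R `^ theta)) `^ p) ->
  a <= 600 * lambda * expR 2 * (ln n%:R `^ theta * rho / n%:R `^ p^-1).
Proof.
move=> n1 a0 p1 l1 rho0 /andP[t0 t1].
have n0 : 0 < n%:R :> R by rewrite ltr0n ltnW.
(* This is what gives ln n + 1 <= 3 ln n below. *)
have lnn : 2^-1 <= ln n%:R :> R.
  have := expR_ge1Dx (- 2^-1 : R); rewrite expRN => h.
  rewrite -ler_expR lnK ?posrE//.
  apply: (@le_trans _ _ 2); last by rewrite ler_nat.
  rewrite -[leRHS]invrK -[leLHS]invrK lef_pV2 ?posrE ?invr_gt0 ?expR_gt0//; lra.
set m := (Num.Def.trunc (ln n%:R : R)).+1.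
have ln0 : 0 <= ln n%:R :> R by lra.
have [m1 m2] : ln n%:R < m%:R :> R /\ m%:R <= ln n%:R + 1 :> R.
  have /andP[h1 h2] := Num.Theory.truncn_itv ln0.
  by rewrite /m -[in X in _ /\ X]natr1 lerD2r.
have m0 : (0 < m)%N by [].
clearbody m; move=> /(_ m m0).
have p0 : 0 < p by lra.
have l0 : 0 <= lambda by lra.
(* This scaling turns n a^p into b^p; since lambda <= lambda^p, the exponent p can then be dropped
   on both sides. *)
set b := a * n%:R `^ p^-1.
have b0 : 0 <= b by rewrite mulr_ge0// powR_ge0.
have -> : n%:R * a `^ p = b `^ p.
  by rewrite /b powRM ?powR_ge0// -powRrM mulVf ?gt_eqF// powRr1 ?ltW// mulrC.
set Y := rho ^+ m * _.
have Y0 : 0 <= Y by rewrite !mulr_ge0 ?exprn_ge0 ?powR_ge0.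
rewrite -powR_mulrn ?powR_ge0// -powRrM mulrC powRrM powR_mulrn//.
move=> h; have {h} h : (b ^+ m) `^ p <= (lambda * Y) `^ p.
  by apply: le_trans h _; rewrite powRM// ler_wpM2r ?powR_ge0// le1r_powR.
have {h} h : b ^+ m <= lambda * Y.
  move: h; rewrite !leNgt; apply: contra => h.
  apply: gt0_ltr_powR => //; rewrite nnegrE ?exprn_ge0//; exact: mulr_ge0.
set c := rho * m%:R `^ theta; set D := lambda * 100 * 2 * expR 2.
have c0 : 0 <= c by rewrite mulr_ge0// powR_ge0.
have D0 : 0 <= D by rewrite !mulr_ge0// expR_ge0.
have {h} h : b ^+ m <= (D * c) ^+ m.
  apply: le_trans h _.
  have -> : lambda * Y = (lambda * 100 * m%:R * n%:R ^+ 2) * c ^+ m.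
    have E0 : (m ^ m)%:R `^ theta = (m%:R `^ theta) ^+ m :> R.
      by rewrite natrX powR_exprn.
    rewrite /Y /c exprMn E0 !natrM; ring.
  rewrite [(D * c) ^+ m]exprMn; apply: ler_wpM2r; first exact: exprn_ge0.
  rewrite /D [leRHS]exprMn [(_ * _ * _) ^+ m]exprMn.
  (* Each factor is bounded by the m-th power of a constant; for n^2 this uses n <= e^m, that is, ln
     n <= m. *)
  have E1 : lambda * 100 <= (lambda * 100) ^+ m by rewrite ler_eXnr//; lra.
  have E2 : m%:R <= 2 ^+ m :> R by rewrite -natrX ler_nat ltnW// ltn_expl.
  have E3 : n%:R ^+ 2 <= expR 2 ^+ m :> R.
    have -> : expR 2 = expR 1 ^+ 2 :> R by rewrite -expRM_natl mulr1.
    rewrite exprAC ler_sqr ?nnegrE// ?exprn_ge0 ?expR_ge0//.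
    by rewrite -expRM_natl mulr1 -[leLHS]lnK ?posrE// ler_expR ltW.
  apply: ler_pM => //; rewrite ?mulr_ge0 ?exprn_ge0//.
  by apply: ler_pM => //; rewrite mulr_ge0.
have {h} h : b <= D * c.
  by rewrite -(ler_pXn2r (n := m)) ?nnegrE// mulr_ge0.
have mt : m%:R `^ theta <= 3 * ln n%:R `^ theta.
  apply: (@le_trans _ _ ((3 * ln n%:R) `^ theta)).
    by apply: ge0_ler_powR; rewrite ?nnegrE//; lra.
  rewrite powRM//.
  by apply: ler_wpM2r; rewrite ?powR_ge0// ler1_powR; lra.
have nV : 0 < n%:R `^ p^-1 :> R by rewrite powR_gt0.
rewrite mulrA ler_pdivlMr//; apply: le_trans h _.
rewrite /D /c.
have -> : 600 * lambda * expR 2 * (ln n%:R `^ theta * rho) =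
  lambda * 100 * 2 * expR 2 * (rho * (3 * ln n%:R `^ theta)) by ring.
by rewrite ler_wpM2l// ler_wpM2l.
Qed.

End Numerics.

(** * Comparison of the balls of l_q^n *)

Section Balls.
Variable R : realType.

(** The power mean inequality with exponent s/2, applied to the squares, bounds their mean by
    n^(-2/s). *)
Lemma sum_sqr_lq_le (n : nat) (x : 'I_n -> R) (s : R) : (0 < n)%N -> 2 <= s ->
  (forall i, 0 <= x i) -> \sum_i x i `^ s <= 1 ->
  \sum_i (x i / n%:R `^ (2^-1 - s^-1)) `^ 2 <= 1.
Proof.
move=> n0 s2 x0 xs; have n0' : 0 < n%:R :> R by rewrite ltr0n.
set rho := n%:R `^ _; have rho0 : 0 < rho by rewrite powR_gt0.
have s0 : 0 < s by lra.
have := @powR_mean_le R n (fun i => x i `^ 2) (s / 2) n0.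
set a := _ * \sum_i _ => /(_ _ _)/le_trans h.
have a0 : 0 <= a by rewrite mulr_ge0 ?invr_ge0// sumr_ge0// => i _; rewrite powR_ge0.
have {h} h : n%:R * a `^ (s / 2) <= 1.
  apply: h; [by lra|by move=> i; rewrite powR_ge0|].
  apply: le_trans xs; rewrite le_eqVlt; apply/orP; left; apply/eqP.
  by apply: eq_bigr => i _; rewrite -powRrM; congr (_ `^ _); field.
have {h} h : a / (rho ^+ 2 / n%:R) <= 1.
  have -> : rho ^+ 2 / n%:R = n%:R `^ (- (2 / s)).
    rewrite -powR_mulrn ?powR_ge0// -powRrM -[n%:R^-1]powR_inv1 ?(ltW n0')//.
    rewrite -powRD; last first.
      by rewrite (gt_eqF n0') implybT.
    by congr (_ `^ _); field; rewrite gt_eqF.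
  apply: (le1_of_powR_le1 (s := s / 2)); first by lra.
    by rewrite divr_ge0 ?powR_ge0.
  rewrite powRM ?invr_ge0 ?powR_ge0// -powRN opprK -powRrM.
  have -> : 2 / s * (s / 2) = 1 by field; rewrite gt_eqF.
  by rewrite powRr1 ?(ltW n0')// mulrC.
apply: (le_trans _ h).
have -> : a / (rho ^+ 2 / n%:R) = (\sum_i x i `^ 2) / rho ^+ 2.
  by rewrite /a; field; rewrite !gt_eqF.
rewrite mulr_suml ler_sum// => i _.
rewrite powRM ?invr_ge0 ?(ltW rho0)// ler_wpM2l ?powR_ge0//.
by rewrite powR_mulrn ?invr_ge0 ?(ltW rho0)// exprVn.
Qed.

(** The witness is min(q, 2). For q <= 2 the dilation factor is n^0 = 1; for finite q > 2 this is
    [sum_sqr_lq_le]. *)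
Lemma lq_ball_sub (q : \bar R) (n : nat) : (1 <= q)%E -> (0 < n)%N ->
  exists s : R, [/\ 1 <= s <= 2, fine (Order.min q 2%:E)^-1 = s^-1 &
    forall z : 'rV[R[i]]_n, lq_ball q z ->
    \sum_i (rnorm (z 0 i) / n%:R `^ (2^-1 - fine (Order.max 2%:E q)^-1)) `^ s <= 1].
Proof.
case: q => [s| |]//; rewrite ?lee_fin => q1 n0; last first.
  (* For q = +oo the factor is n^(1/2), and each of the n terms is at most 1/n. *)
  exists 2; split; [lra|by rewrite minye fine_invr|move=> z /= zq].
  rewrite maxey invey /= subr0.
  apply: (@le_trans _ _ (\sum_(i < n) n%:R^-1)); last first.
    by rewrite sumr_const card_ord -[_ *+ n]mulr_natr mulVf// pnatr_eq0 -lt0n.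
  apply: ler_sum => i _; rewrite powRM ?rnorm_ge0 ?invr_ge0 ?powR_ge0//.
  rewrite -[n%:R^-1]mul1r -powRN -powRrM.
  have -> : - 2^-1 * 2 = -1 :> R by field.
  rewrite powR_inv1// ler_wpM2r ?invr_ge0// powR_mulrn ?rnorm_ge0//.
  rewrite exprn_ile1 ?rnorm_ge0//; apply: le_trans (ltW zq).
  exact: (le_bigmax _ (fun i => rnorm (z 0 i))).
rewrite -EFin_min -EFin_max !fine_invr.
have zs (z : 'rV[R[i]]_n) : lq_ball s%:E z -> \sum_i rnorm (z 0 i) `^ s <= 1.
  move=> /ltW; apply: le1_of_powR_le1; first by rewrite invr_gt0; lra.
  by rewrite sumr_ge0// => i _; rewrite powR_ge0.
have [s2|s2] := leP s 2.
  exists s; split => [|//|z /zs h]; first by rewrite q1.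
  apply: le_trans h; apply: ler_sum => i _.
  by rewrite subrr powRr0 divr1.
exists 2; split => [|//|z /zs h]; first by lra.
by apply: sum_sqr_lq_le => //; [exact: ltW|move=> i; exact: rnorm_ge0].
Qed.

Lemma lq_ball_const (q : \bar R) (n : nat) (s : R) : (1 <= q)%E -> (0 < n)%N ->
  0 <= s < 1 -> lq_ball q (const_mx (s / n%:R `^ fine q^-1)%:C%C : 'rV[R[i]]_n).
Proof.
move=> q1 n0 /andP[s0 s1]; have n0' : 0 < n%:R :> R by rewrite ltr0n.
case: q q1 => [r| |]//; rewrite ?lee_fin => q1; rewrite /lq_ball /=; last first.
  apply: bigmax_lt => // i _.
  by rewrite mxE /= powRr0 divr1 rnorm_real ger0_norm.
have r0 : 0 < r by lra.
under eq_bigr do rewrite mxE rnorm_real fine_invr (ger0_norm (divr_ge0 s0 (powR_ge0 _ _))).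
rewrite sumr_const card_ord powRM ?invr_ge0 ?powR_ge0// -powRN -powRrM.
rewrite mulNr mulVf ?gt_eqF//.
rewrite powR_inv1 ?(ltW n0')// -[_ *+ n]mulr_natr mulfVK ?gt_eqF//.
by rewrite -powRrM mulfV ?gt_eqF// powRr1.
Qed.

Lemma lq_ball0 (q : \bar R) (n : nat) : (1 <= q)%E -> (0 < n)%N ->
  lq_ball q (0 : 'rV[R[i]]_n).
Proof.
move=> q1 n0; have := lq_ball_const q1 n0 (_ : 0 <= 0 < 1).
by rewrite mul0r lexx ltr01 => /(_ erefl).
Qed.

End Balls.

(** * Lower and upper bounds for the arithmetic Bohr radius *)

Section Bounds.
Variables (R : realType) (X : completeNormedModType R[i]).

Lemma monomial0 (n : nat) (a : {ffun 'I_n -> nat}) :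
  monomial (0 : 'rV[R[i]]_n) a = (a == [ffun=> 0%N])%:R.
Proof.
rewrite /monomial; case: eqP => [->|/eqP a0].
  by apply: big1 => i _; rewrite ffunE expr0.
have [i ai] : exists i, a i != 0%N.
  apply/existsP; apply: contraNT a0 => /existsPn a0.
  by apply/eqP/ffunP => i; rewrite ffunE; apply/eqP; have := a0 i; rewrite negbK.
by rewrite (bigD1 i)//= mxE expr0n (negPf ai) mul0r.
Qed.

(** At the origin only the constant term survives, and limits are unique. *)
Lemma monomial_coeffs0 (n : nat) (Omega : set 'rV[R[i]]_n) (f : 'rV[R[i]]_n -> X) x :
  Omega 0 -> monomial_coeffs Omega f x -> x [ffun=> 0%N] = f 0.
Proof.
move=> O0 /(_ 0 O0) fx.
apply: (@norm_cvg_unique _ X _ (fmap_proper_filter _ totally_filter) _ _ _ fx).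
suff h : \forall A \near totally,
    partial_sum (fun a => monomial (0 : 'rV[R[i]]_n) a *: x a) A = x [ffun=> 0%N].
  apply: (@cvg_near_cst _ X _ _ totally _ h).
  exact: (@filter_filter _ _ totally_filter).
exists [fset [ffun=> 0%N]]%fset => // A /= sA.
rewrite /partial_sum -(big_seq_fsetE _ _ predT (fun a => monomial 0 a *: x a)) /=.
rewrite -(big_fset_incl _ sA) ?big_seq_fset1 ?monomial0 ?eqxx ?scale1r//.
by move=> a _; rewrite inE => aN; rewrite monomial0 (negPf aN) scale0r.
Qed.

Lemma sup_norm_ge (n : nat) (Omega : set 'rV[R[i]]_n) (f : 'rV[R[i]]_n -> X) z :
  Omega z -> ((rnorm (f z))%:E <= sup_norm Omega f)%E.
Proof. by move=> Oz; apply: ereal_sup_ubound; exists z. Qed.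

(** Only the constant term f(0) remains. This makes the arithmetic radius nonnegative, which starts
    the comparison with the Bohr radius. *)
Lemma arith_bohr_admissible0 (n : nat) (Omega : set 'rV[R[i]]_n) (p lambda : R) :
  Omega 0 -> 0 < p -> 1 <= lambda -> arith_bohr_admissible X Omega p lambda (fun=> 0).
Proof.
move=> O0 p0 l1 f x _ fb fx.
apply: (@le_trans _ _ (\esum_(a in [set [ffun=> 0%N]]) (rnorm (x a) `^ p)%:E)%E).
  rewrite [leRHS]esum_mkcond; apply: le_esum => a _.
  have [a0|a0] := pselect (a = [ffun=> 0%N]).
    rewrite mem_set//= big1 ?mulr1// => i _.
    by rewrite a0 ffunE mulr0 powRr0.
  rewrite memNset//= lee_fin.
  have [i ai] : exists i, a i != 0%N.
    apply/existsP; move/eqP: a0; apply: contraNT => /existsPn a0.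
    by apply/eqP/ffunP => i; rewrite ffunE; apply/eqP; have := a0 i; rewrite negbK.
  have pa : p * (a i)%:R != 0 by rewrite mulf_neq0 ?pnatr_eq0// gt_eqF.
  by rewrite (bigD1 i)//= powR0// mul0r mulr0.
rewrite esum_set1 ?lee_fin ?powR_ge0// (monomial_coeffs0 O0 fx).
have h := sup_norm_ge f O0.
have h0 : (0 <= sup_norm Omega f)%E by apply: le_trans h; rewrite lee_fin rnorm_ge0.
apply: (@le_trans _ _ (sup_norm Omega f `^ p)%E).
  rewrite -poweR_EFin; apply: gt0_ler_poweR.
  all: rewrite ?in_itv/= ?leey ?andbT ?lee_fin ?rnorm_ge0//.
  exact: ltW.
by rewrite -[leLHS]mul1e lee_wpmul2r ?poweR_ge0// lee_fin.
Qed.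

Lemma arith_bohr_radius_ge (n : nat) (Omega : set 'rV[R[i]]_n) (p lambda t : R) :
  (0 < n)%N -> 0 <= t ->
  arith_bohr_admissible X Omega p lambda (fun=> t) ->
  (t%:E <= arith_bohr_radius X Omega p lambda)%E.
Proof.
move=> n0 t0 ta; apply: ereal_sup_ubound; exists (fun=> t) => //=.
by rewrite sumr_const card_ord -[t *+ n]mulr_natl mulKf// pnatr_eq0 -lt0n.
Qed.

(** At the point of [dilate r] with all entries r s/c, the Bohr sum is the arithmetic sum for the
    constant radius r s/c; s < 1 is arbitrary. *)
Lemma bohr_radius_le (q : \bar R) (n : nat) (p lambda : R) :
  (1 <= q)%E -> (0 < n)%N -> 1 <= p -> 1 <= lambda ->
  ((bohr_radius X (@lq_ball R q n) p lambda / n%:R `^ fine q^-1)%:E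
       <= arith_bohr_radius X (@lq_ball R q n) p lambda)%E.
Proof.
move=> q1 n0 p1 l1; have n0' : 0 < n%:R :> R by rewrite ltr0n.
set c := n%:R `^ _; have c0 : 0 < c by rewrite powR_gt0.
have p0 : 0 < p by lra.
have A0 := arith_bohr_radius_ge n0 (lexx 0)
  (arith_bohr_admissible0 (lq_ball0 q1 n0) p0 l1).
have key r s : 0 <= r -> 0 <= s < 1 -> bohr_admissible X (@lq_ball R q n) p lambda r ->
    ((r * (s / c))%:E <= arith_bohr_radius X (@lq_ball R q n) p lambda)%E.
  move=> r0 s01 ra; have /andP[s0 s1] := s01.
  have t0 : 0 <= r * (s / c) by rewrite mulr_ge0// divr_ge0// ltW.
  apply: arith_bohr_radius_ge => // f x fh _ fx.
  apply: le_trans (ra f x fh fx); apply: ereal_sup_ubound.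
  exists (r%:C%C *: const_mx (s / c)%:C%C).
    by exists (const_mx (s / c)%:C%C) => //; exact: lq_ball_const.
  apply: eq_esum => a _; congr EFin.
  rewrite rnormZ powRM ?rnorm_ge0// mulrC; congr (_ * _); apply: esym.
  rewrite /monomial rnorm_prod.
  have -> : \prod_(i < n)
      rnorm ((r%:C%C *: const_mx (s / c)%:C%C : 'rV[R[i]]_n) 0 i ^+ a i) =
     \prod_(i < n) (r * (s / c)) `^ (a i)%:R.
    apply: eq_bigr => i _; rewrite !mxE rnormX rnormM !rnorm_real.
    rewrite (ger0_norm r0) (ger0_norm (divr_ge0 s0 (ltW c0))).
    by rewrite [RHS]powR_mulrn.
  rewrite powR_prod => [|i _]; last exact: powR_ge0.
  by apply: eq_bigr => i _; rewrite -powRrM [_ * p]mulrC.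
rewrite /bohr_radius; set S := [set r | _]%classic.
case: (arith_bohr_radius _ _ _ _) A0 key => [A| |]// A0 key; last by rewrite leey.
rewrite lee_fin ler_pdivrMr//.
rewrite lee_fin in A0.
(* The supremum of the empty set is 0, and 0 <= A is known. *)
have [->|/set0P S0] := eqVneq S set0.
  by rewrite sup0 mulr_ge0// ltW.
apply: ge_sup => // r [/andP[r0 r1] ra].
rewrite -ler_pdivrMr// leNgt; apply/negP => Ab.
have b0 : 0 < r / c by lra.
(* This s makes r s/c the midpoint of A and r/c, which exceeds A and contradicts [key]. *)
have s01 : 0 <= (A + r / c) / (2 * (r / c)) < 1.
  have d0 : 0 < 2 * (r / c) by rewrite mulr_gt0.
  by apply/andP; split; [apply: divr_ge0|rewrite ltr_pdivrMr//]; lra.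
have := key r _ r0 s01 ra; rewrite lee_fin.
have rn0 : r != 0 by apply: contraTneq b0 => ->; rewrite mul0r ltxx.
have -> : r * ((A + r / c) / (2 * (r / c)) / c) = (A + r / c) / 2.
  by field; rewrite rn0 gt_eqF.
lra.
Qed.

Lemma signed_polyZ (n m : nat) e (c : R[i]) (u : 'I_n -> R[i]) :
  signed_poly m e (fun i => c * u i) = c ^+ m * signed_poly m e u.
Proof.
rewrite !signed_polyE mulr_sumr; apply: eq_bigr => w _.
by rewrite big_split /= prodr_const card_ord; ring.
Qed.

Lemma arith_bohr_radius_le (q : \bar R) (n : nat) (p lambda : R) (v : X) :
  (1 <= q)%E -> (1 < n)%N -> 1 <= p -> 1 <= lambda -> v != 0 ->
  (arith_bohr_radius X (@lq_ball R q n) p lambda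
       <= (600 * lambda * expR 2 * (ln n%:R `^ (1 - fine (Order.min q 2%:E)^-1)
                / n%:R `^ (p^-1 + fine (Order.max 2%:E q)^-1 - 2^-1)))%:E)%E.
Proof.
move=> q1 n1 p1 l1 v0; have n0 := ltnW n1.
have [s [s12 -> sub]] := lq_ball_sub q1 n0.
move: sub; set k := fine _; set rho := _ `^ (_ - k) => sub.
have n0' : 0 < n%:R :> R by rewrite ltr0n.
have rho0 : 0 < rho by rewrite powR_gt0.
apply: ge_ereal_sup => _ [r [r0 ra] <-]; rewrite lee_fin.
have -> : ln n%:R `^ (1 - s^-1) / n%:R `^ (p^-1 + k - 2^-1) =
    ln n%:R `^ (1 - s^-1) * rho / n%:R `^ p^-1.
  rewrite -mulrA; congr (_ * _).
  rewrite -!powRN -powRD; last by rewrite (gt_eqF n0') implybT.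
  by congr (_ `^ _); ring.
apply: root_bound => //.
- by rewrite mulr_ge0 ?invr_ge0// sumr_ge0.
- exact: ltW.
- by rewrite subr_ge0 gerBl invr_ge0 invf_le1; lra.
move=> m m0; have [e he] := exists_signed_poly_bound s12 n0 m0.
apply: le_trans (arith_admissible_le (m := m) (e := e) v0 p1 _ (lq_ball0 q1 n0) r0 _ ra).
- apply: lerXn2r; rewrite ?nnegrE ?mulr_ge0 ?powR_ge0//.
    by rewrite sumr_ge0// => i _; rewrite powR_ge0.
  exact: powR_mean_le.
- lra.
move=> z /sub zs.
(* A point of the ball is [rho] times a point of the l_s ball, and homogeneity of degree m extracts
   rho^m. *)
pose u i : R[i] := (rho^-1)%:C%C * z 0 i.
have -> : (fun i => z 0 i) = (fun i => rho%:C%C * u i).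
  apply/funext => i; rewrite /u mulrA -rmorphM mulfV ?gt_eqF//.
  by rewrite mul1r.
rewrite signed_polyZ rnormM rnormX rnorm_real (gtr0_norm rho0).
apply: ler_wpM2l; first by rewrite exprn_ge0// ltW.
apply: he; apply: le_trans zs; apply: ler_sum => i _.
by rewrite rnormM rnorm_real ger0_norm ?invr_ge0 ?(ltW rho0)// mulrC.
Qed.

End Bounds.

(* [fine q^-1] is 1/q, with 1/+oo = 0. *)
Theorem theorem2p2 (R : realType) (X : completeNormedModType R[i]) (p lambda : R)
    (X_neq0 : exists v : X, v != 0) (p_ge1 : 1 <= p) (lambda_ge1 : 1 <= lambda) :
  exists2 d : R, 0 < d &
    forall (q : \bar R) (n : nat), (1 <= q)%E -> (1 < n)%N ->
    ((bohr_radius X (@lq_ball R q n) p lambda / n%:R `^ fine q^-1)%:E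
       <= arith_bohr_radius X (@lq_ball R q n) p lambda)%E /\
    (arith_bohr_radius X (@lq_ball R q n) p lambda
       <= (d * (ln n%:R `^ (1 - fine (Order.min q 2%:E)^-1)
                / n%:R `^ (p^-1 + fine (Order.max 2%:E q)^-1 - 2^-1)))%:E)%E.
Proof.
have [v v0] := X_neq0.
(* The constant of [root_bound], which depends on [lambda] alone. *)
exists (600 * lambda * expR 2).
  apply: mulr_gt0; last exact: expR_gt0.
  by apply: mulr_gt0; [rewrite ltr0n|lra].
move=> q n q1 n1; split; first by apply: bohr_radius_le => //; exact: ltnW.
exact: arith_bohr_radius_le q1 n1 p_ge1 lambda_ge1 v0.
Qed.
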